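(* For $\epsilon\in(0,\frac12]$ let $$B_\epsilon := \{(x,y)\in\mathbb{R}^2 : x\le\Phi^{-1}(\epsilon),\ y\ge\Phi^{-1}(1-\epsilon),\ x-y\le 2\Phi^{-1}(\epsilon/2)\}.$$ The family of polyhedral outer approximations $B_\epsilon$ forms a $1.25$-approximation of $S_\epsilon$.
   Context: $\Phi$ is the cumulative distribution function of the standard Gaussian distribution, and $\Phi^{-1}$ its inverse. For $\epsilon\in(0,1)$, $S_\epsilon := \{(x,y)\in\mathbb{R}^2 : x\le y,\ \Phi(y)-\Phi(x)\ge 1-\epsilon\}$. A polyhedron $P_\epsilon\subset\mathbb{R}^2$ is an outer approximation of $S_\epsilon$ if $S_\epsilon\subset P_\epsilon$. A family of polyhedral outer approximations $(P_\epsilon)_{\epsilon\in(0,1/2]}$ forms an $\alpha$-approximation of $S_\epsilon$ if for all $\epsilon\in(0,\frac12]$ and all $(x,y)\in P_\epsilon$ one has $\Phi(y)-\Phi(x)\ge 1-\alpha\epsilon$. *)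

(* Defs.v *)
From HB Require Import structures.
From mathcomp Require Import all_boot all_order all_algebra.
From mathcomp Require Import all_classical all_reals all_analysis.

Set Implicit Arguments.
Unset Strict Implicit.
Unset Printing Implicit Defensive.

Import Order.TTheory GRing.Theory Num.Theory.
Import numFieldNormedType.Exports.

Local Open Scope classical_set_scope.
Local Open Scope ring_scope.

Section gaussian_interval_set.
Context {R : realType}.

Definition std_normal : probability (measurableTypeR R) R := normal_prob 0 1.

Definition id_rv : measurableTypeR R -> R := idfun.

HB.instance Definition _ :=
  @isMeasurableFun.Build _ _ _ _ id_rv (@measurable_id _ _ setT).

Definition Phi (x : R) : R := fine (cdf (id_rv : {RV std_normal >-> R}) x).

(* Phi is a bijection from R onto ]0, 1[, so on ]0, 1[ this is its inverse;
   at every other argument it takes the junk value 0. *)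
Definition Phi_inv : R -> R := 'pinv_(fun=> 0) [set: R] Phi.

Definition S_set (eps : R) : set (R * R) :=
  [set p | p.1 <= p.2 /\ Phi p.2 - Phi p.1 >= 1 - eps].

Definition polyhedron (P : set (R * R)) : Prop :=
  exists (m : nat) (a b c : 'I_m -> R),
    P = [set p | forall i, a i * p.1 + b i * p.2 <= c i].

Definition outer_approximation (eps : R) (P : set (R * R)) : Prop :=
  polyhedron P /\ S_set eps `<=` P.

(* A family indexed by ]0, 1/2] is encoded as a total function of eps whose
   values outside ]0, 1/2] are irrelevant. *)
Definition alpha_approximation (alpha : R) (P : R -> set (R * R)) : Prop :=
  forall eps : R, 0 < eps <= 1 / 2 ->
    outer_approximation eps (P eps) /\
    (forall x y : R, P eps (x, y) -> Phi y - Phi x >= 1 - alpha * eps).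

Definition B_set (eps : R) : set (R * R) :=
  [set p | [/\ p.1 <= Phi_inv eps, p.2 >= Phi_inv (1 - eps)
             & p.1 - p.2 <= 2 * Phi_inv (eps / 2)]].

End gaussian_interval_set.

(* Main.v *)
(**
Put z = - y, so that 1 - (Phi y - Phi x) = Phi x + Phi z by symmetry, and let
b = Phi^-1 (eps), m = Phi^-1 (eps / 2); then B_eps is the region x <= b,
z <= b, x + z <= 2 m.  Since b <= 0, Phi is convex on the relevant half-line.
Midpoint convexity gives S_eps `<=` B_eps.  Conversely, on B_eps the convex
function Phi x + Phi z is maximal at the vertex (b, 2 m - b), where it equals
eps + Phi (2 m - b), and log-concavity of Phi at 2 m - b, m, b gives
Phi (2 m - b) <= (eps / 2)^2 / eps = eps / 4.
*)

Require Import Defs.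
From mathcomp Require Import all_boot all_order all_algebra.
From mathcomp Require Import all_classical all_reals all_analysis.
From mathcomp Require Import ring lra.

Set Implicit Arguments.
Unset Strict Implicit.
Unset Printing Implicit Defensive.

Import Order.TTheory GRing.Theory Num.Theory.
Import numFieldNormedType.Exports.

Local Open Scope classical_set_scope.
Local Open Scope ring_scope.

Section derivative_sign.
Context {R : realType}.
Implicit Types f df : R -> R.

Lemma is_derive_continuous f df :
  (forall x : R, is_derive x 1 f (df x)) -> continuous f.
Proof.
move=> fdf x; apply/differentiable_continuous/derivable1_diffP.
by have [] := fdf x.
Qed.

Lemma is_derive_ge0_le f df a b :
  (forall x : R, is_derive x 1 f (df x)) -> a <= b ->
  (forall x, a <= x <= b -> 0 <= df x) -> f a <= f b.
Proof.
move=> fdf ab df0.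
have [|c + fab] := @MVT_segment _ f df a b ab (fun x _ => fdf x).
  exact/continuous_subspaceT/is_derive_continuous.
rewrite in_itv/= => /df0 dfc.
by rewrite -subr_ge0 fab mulr_ge0 // subr_ge0.
Qed.

Lemma is_derive_gt0_lt f df a b :
  (forall x : R, is_derive x 1 f (df x)) -> (forall x, 0 < df x) ->
  a < b -> f a < f b.
Proof.
move=> fdf df0 ab.
have [|c _ fab] := @MVT _ f df a b ab (fun x _ => fdf x).
  exact/continuous_subspaceT/is_derive_continuous.
by rewrite -subr_gt0 fab mulr_gt0 // subr_gt0.
Qed.

End derivative_sign.

Section gaussian_cdf.
Context {R : realType}.
Implicit Types x y h d : R.

Let phi : R -> R := normal_pdf 0 1.

Let phiE x : phi x = normal_peak 1 * expR (- (x ^+ 2 / 2)).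
Proof.
by rewrite /phi normal_pdfE ?oner_eq0// /normal_fun subr0 expr1n mulNr.
Qed.

Lemma normal_pdf01_gt0 x : 0 < phi x.
Proof. by rewrite phiE mulr_gt0 ?expR_gt0// normal_peak_gt0 ?oner_eq0. Qed.

Lemma normal_pdf01_even x : phi (- x) = phi x.
Proof. by rewrite !phiE sqrrN. Qed.

Lemma normal_pdf01_le x y : y ^+ 2 <= x ^+ 2 -> phi x <= phi y.
Proof.
move=> xy; rewrite !phiE ler_pM2l ?normal_peak_gt0 ?oner_eq0//.
by rewrite ler_expR lerN2 ler_pM2r ?invr_gt0.
Qed.

(* Monotone likelihood ratio: phi (y - h) / phi y = exp (h y - h^2 / 2). *)
Lemma normal_pdf01_ratio x y h : 0 <= h -> x <= y ->
  phi (x - h) * phi y <= phi (y - h) * phi x.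
Proof.
move=> h0 xy; rewrite !phiE.
set c := normal_peak 1.
rewrite mulrACA [leRHS]mulrACA -!expRD ler_pM2l; last first.
  by rewrite mulr_gt0 ?normal_peak_gt0 ?oner_eq0.
by rewrite ler_expR; nra.
Qed.

Lemma is_derive_Phi x : is_derive x 1 Phi (phi x).
Proof.
(* [Phi x] unfolds to the integral of [phi] over the half-line up to [x]; [x + 1] is an arbitrary
   point to the right of [x]. *)
have [] := @continuous_FTC1 R phi -oo%O x (x + 1).
- by rewrite ltrDl.
- apply: (integrableS measurableT) => //; exact: integrable_normal_pdf.
- exact: ltNyr.
- exact: (@continuous_normal_pdf R 0 1 (oner_neq0 R) x).
by move=> dF F'; split=> //; rewrite -derive1E.
Qed.

Lemma Phi_lt x y : x < y -> Phi x < Phi y.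
Proof. by apply: is_derive_gt0_lt is_derive_Phi normal_pdf01_gt0. Qed.

Lemma Phi_le_mono : {mono (@Phi R) : x y / x <= y}.
Proof. by apply: le_mono => x y; exact: Phi_lt. Qed.

Lemma cvg_PhiNy : Phi x @[x --> -oo] --> (0 : R).
Proof. exact/fine_cvg/cvg_cdfNy0. Qed.

Lemma cvg_Phiy : Phi x @[x --> +oo] --> (1 : R).
Proof. exact/fine_cvg/cvg_cdfy1. Qed.

Lemma Phi_ge0 x : 0 <= Phi x.
Proof. by rewrite fine_ge0. Qed.

Lemma is_derive_Phi_shift x d :
  is_derive x 1 (fun u => Phi (u + d)) (phi (x + d)).
Proof.
rewrite -[phi _]mulr1.
exact: (@is_derive1_comp _ Phi (shift d) x _ _
  (is_derive_Phi _) (is_derive_shift _ _ _)).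
Qed.

(** Since [phi] is even, [G u = Phi u + Phi (- u)] has zero derivative; its constant value is its
    limit 1 at [+oo]. *)
Lemma PhiN x : Phi (- x) = 1 - Phi x.
Proof.
pose G := (fun u : R => Phi u + Phi (- u)).
have dG (u : R) : is_derive u 1 G 0.
  have dN : is_derive u 1 (fun u => Phi (- u)) (phi (- u) * (- 1)).
    exact: (@is_derive1_comp _ Phi -%R u _ _
      (is_derive_Phi _) (is_deriveNid _ _)).
  have -> : 0 = phi u + phi (- u) * (- 1).
    by rewrite normal_pdf01_even mulrN1 subrr.
  exact: is_deriveD (is_derive_Phi u) dN.
have Gcst u : G u = G x by exact: is_derive_0_is_cst.
have G1 : G u @[u --> +oo] --> (1 + 0 : R).
  by apply: cvgD; [exact: cvg_Phiy|exact: (cvgNy_compNP _ _).1 cvg_PhiNy].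
have Gx : G u @[u --> +oo] --> G x.
  by rewrite (_ : G = cst (G x)); [exact: cvg_cst|exact/funext].
have : G x = 1 + 0 by exact: cvg_unique Gx G1.
by rewrite /G; lra.
Qed.

Lemma Phi_inj : injective (@Phi R).
Proof. exact: inc_inj Phi_le_mono. Qed.

Lemma Phi_surj (p : R) : 0 < p < 1 -> exists x : R, Phi x = p.
Proof.
move=> /andP[p0 p1].
have [a ap] : exists a : R, Phi a < p.
  near (ninfty_nbhs R) => a; exists a; near: a.
  exact: cvgr_lt cvg_PhiNy _ p0.
have [b pb] : exists b : R, p < Phi b.
  near (pinfty_nbhs R) => b; exists b; near: b.
  exact: cvgr_gt cvg_Phiy _ p1.
have ab : a <= b by rewrite -Phi_le_mono ltW// (lt_trans ap).
have [||c _ <-] := @IVT R Phi a b p ab; last by exists c.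
  exact/continuous_subspaceT/is_derive_continuous/is_derive_Phi.
rewrite ge_min le_max; apply/andP; split; apply/orP; [left|right]; exact: ltW.
Unshelve. all: end_near. Qed.

Lemma Phi_invK (p : R) : 0 < p < 1 -> Phi (Phi_inv p) = p.
Proof.
move=> /Phi_surj[x <-]; rewrite /Phi_inv pinvKV ?inE//.
by move=> ? ? _ _; exact: Phi_inj.
Qed.

(** A form of convexity that also allows [y + d > 0]. For [u <= y],
    [(u + d)^2 - u^2 = d (2 u + d) <= 0], so [phi u <= phi (u + d)] and the increment over a step
    [d] grows with [u]. *)
Lemma Phi_incr x y d : 0 <= d -> x <= y -> 2 * y + d <= 0 ->
  Phi (x + d) - Phi x <= Phi (y + d) - Phi y.
Proof.
move=> d0 xy yd.
apply: (@is_derive_ge0_le _ (fun u => Phi (u + d) - Phi u)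
  (fun u => phi (u + d) - phi u)) => // u.
  have := is_derive_Phi_shift u d; have := is_derive_Phi u => *.
  exact: is_derive_eq.
move=> /andP[_ uy]; rewrite subr_ge0 normal_pdf01_le//; nra.
Qed.

(* With r = phi (x - h) / phi x, the function g u = Phi (u - h) - r Phi u is
   decreasing on ]-oo, x], increasing on [x, +oo[ and vanishes at -oo; the
   inequality follows from g x <= 0 and g x <= g (x + h). *)
Lemma Phi_log_concave x h : 0 <= h -> Phi (x - h) * Phi (x + h) <= Phi x ^+ 2.
Proof.
move=> h0; pose r := phi (x - h) / phi x.
pose g u := Phi (u - h) - r * Phi u.
have px := normal_pdf01_gt0 x.
have dg (u : R) : is_derive u 1 g (phi (u - h) - r * phi u).
  have := is_derive_Phi_shift u (- h); have := is_derive_Phi u => *.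
  exact: is_derive_eq.
have gle u : u <= x -> g x <= g u.
  move=> ux; rewrite -lerN2; apply: (@is_derive_ge0_le _ (- g)
    (fun u => - (phi (u - h) - r * phi u))) => // v /andP[_ vx].
  rewrite oppr_ge0 subr_le0 /r mulrAC ler_pdivlMr//.
  exact: normal_pdf01_ratio.
have gx : g x <= 0.
  rewrite leNgt; apply/negP => gx.
  have g0 : g u @[u --> -oo] --> (0 - r * 0 : R).
    apply: cvgB; last by apply: cvgMr; exact: cvg_PhiNy.
    exact: (cvg_comp _ _ (cvg_addrr_Ny _) cvg_PhiNy).
  rewrite mulr0 subr0 in g0.
  near (ninfty_nbhs R) => u.
  have : g u < g x by near: u; exact: cvgr_lt g0 _ gx.
  by rewrite ltNge gle.
have gxh : g x <= g (x + h).
  apply: (@is_derive_ge0_le _ _ _ x (x + h) dg); first by rewrite lerDl.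
  move=> v /andP[xv _]; rewrite subr_ge0 /r mulrAC ler_pdivrMr//.
  exact: normal_pdf01_ratio.
(* Write A, F, B for [Phi] at [x - h], [x], [x + h]. The bounds on [g] read A <= r F and r (B - F)
   <= F - A. As B - F >= 0 and F >= 0, A (B - F) <= r F (B - F) <= F (F - A), that is A B <= F^2. *)
have Fxh : Phi x <= Phi (x + h) by rewrite Phi_le_mono lerDl.
have := Phi_ge0 x.
move: gx gxh; rewrite /g addrK; nra.
Unshelve. all: end_near. Qed.

Lemma Phi_midpoint x y : x <= 0 -> y <= 0 ->
  2 * Phi ((x + y) / 2) <= Phi x + Phi y.
Proof.
wlog xy : x y / x <= y.
  move=> H x0 y0; have [|/ltW] := leP x y => xy; first exact: H.
  by rewrite addrC [leRHS]addrC; exact: H.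
move=> x0 y0.
(* Compare the increments over the two halves of [[x, y]]. *)
have := @Phi_incr x ((x + y) / 2) ((y - x) / 2).
have -> : x + (y - x) / 2 = (x + y) / 2 by lra.
have -> : (x + y) / 2 + (y - x) / 2 = y by lra.
move=> H; have := H ltac:(lra) ltac:(lra) ltac:(lra); lra.
Qed.

(* (b, 2 m - b) is, up to symmetry, the only vertex of the region, and
   Phi x + Phi y is convex there. *)
Lemma Phi_vertex m b x y : m <= b -> b <= 0 -> x <= b -> y <= b ->
  x + y <= 2 * m -> Phi x + Phi y <= Phi b + Phi (2 * m - b).
Proof.
move=> mb b0; wlog xy : x y / x <= y.
  move=> H xb yb s; have [|/ltW] := leP x y => xy; first exact: H.
  by rewrite addrC; apply: H => //; rewrite addrC.
move=> xb yb s.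
(* If [y <= m], both values are at most [Phi m], and midpoint convexity at [b] and [2 * m - b]
   concludes. Otherwise enlarge [x] to [2 * m - y], then slide along the edge of sum [2 * m] to the
   vertex. *)
have [ym|my] := leP y m.
  have := @Phi_midpoint b (2 * m - b) b0 ltac:(lra).
  have -> : (b + (2 * m - b)) / 2 = m by lra.
  have : Phi x <= Phi m by rewrite Phi_le_mono (le_trans xy).
  have : Phi y <= Phi m by rewrite Phi_le_mono.
  lra.
have : Phi x <= Phi (2 * m - y) by rewrite Phi_le_mono; lra.
have := @Phi_incr (2 * m - b) y (b - y).
have -> : 2 * m - b + (b - y) = 2 * m - y by lra.
have -> : y + (b - y) = b by lra.
move=> H; have := H ltac:(lra) ltac:(lra) ltac:(lra); lra.
Qed.

Lemma Phi_inv_onem p : 0 < p < 1 -> Phi_inv (1 - p) = - Phi_inv p :> R.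
Proof.
by move=> p01; apply: Phi_inj; rewrite PhiN !Phi_invK//; lra.
Qed.

Lemma Phi_inv_le0 p : 0 < p <= 1 / 2 -> Phi_inv p <= 0 :> R.
Proof.
move=> p01; rewrite -Phi_le_mono Phi_invK; last lra.
(* Symmetry at 0 forces [Phi 0 = 1 / 2]. *)
have := PhiN 0; rewrite oppr0; lra.
Qed.

Lemma polyhedron_B_set (eps : R) : polyhedron (B_set eps).
Proof.
exists 3%N, (fun i => nth 0 [:: 1; 0; 1] i), (fun i => nth 0 [:: 0; -1; -1] i),
  (fun i => nth 0 [:: Phi_inv eps; - Phi_inv (1 - eps); 2 * Phi_inv (eps / 2)] i).
apply/seteqP; split=> -[x y]/=.
  by move=> [/= ? ? ?] [[|[|[|]]]]//= _; lra.
move=> H; have := H (@Ordinal 3 0 isT); have := H (@Ordinal 3 1 isT).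
by have := H (@Ordinal 3 2 isT) => /= ? ? ?; split=> /=; lra.
Qed.

End gaussian_cdf.

Theorem theorem3 (R : realType) : alpha_approximation (5 / 4 : R) B_set.
Proof.
move=> eps eps01.
have Fb : Phi (Phi_inv eps) = eps by rewrite Phi_invK//; lra.
have Fm : Phi (Phi_inv (eps / 2)) = eps / 2 by rewrite Phi_invK//; lra.
have b0 : Phi_inv eps <= 0 by exact: Phi_inv_le0.
have Nb : Phi_inv (1 - eps) = - Phi_inv eps by rewrite Phi_inv_onem//; lra.
split; [split; first exact: polyhedron_B_set|]; rewrite /B_set Nb.
  move=> [x y] [/= _ xy].
  have Ny := PhiN y; have Fx := Phi_ge0 x; have Fy := Phi_ge0 (- y).
  (* Membership says [Phi x + Phi (- y) <= eps]; both terms are nonnegative, so each is at most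
     [eps]. *)
  have xb : x <= Phi_inv eps by rewrite -Phi_le_mono Fb; lra.
  have yb : - y <= Phi_inv eps by rewrite -Phi_le_mono Fb; lra.
  have mid := @Phi_midpoint _ x (- y) ltac:(lra) ltac:(lra).
  have : (x - y) / 2 <= Phi_inv (eps / 2) by rewrite -Phi_le_mono Fm; lra.
  by split=> /=; lra.
move=> x y [/= xb yb xym].
move: Fb Fm b0 xb yb xym.
set b := Phi_inv eps; set m := Phi_inv (eps / 2) => Fb Fm b0 xb yb xym.
have mb : m <= b by rewrite -Phi_le_mono Fb Fm; lra.
have := @Phi_log_concave _ m (b - m) ltac:(lra).
have -> : m - (b - m) = 2 * m - b by lra.
have -> : m + (b - m) = b by lra.
rewrite Fb Fm => lc.
have lc' : Phi (2 * m - b) <= eps / 4 by nra.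
have := @Phi_vertex _ m b x (- y) mb b0 xb ltac:(lra) xym.
rewrite PhiN Fb; lra.
Qed.
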